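(* Let $\alpha\in(0,1)$, let $\psi_\alpha:(0,\infty)\to(0,\infty)$ be a bijective map, and let $\phi_\alpha(t)=\int_0^t\frac{1}{\psi_\alpha(s)}\,ds$. Let $f:[0,\infty)\to\mathbb{R}$ and let $a\in[0,\infty)$. Then $f$ is $\psi_\alpha$-differentiable at $a$ if and only if the function $g(\tau)=f(\phi_\alpha^{-1}(\tau))$ is differentiable at $\tau_a=\phi_\alpha(a)$. Moreover, the derivatives are related by $$D^{\alpha}_{\psi}f(a)=g'(\tau_a)=f'(\phi_\alpha^{-1}(\tau_a))\cdot(\phi_\alpha^{-1})'(\tau_a)=\psi_\alpha(a)\,f'(a).$$
   Context: The map $\psi_\alpha$ is such that the integral $\phi_\alpha(t)=\int_0^t\frac{1}{\psi_\alpha(s)}\,ds$ is well defined (finite) for $t\ge 0$, and $\phi_\alpha^{-1}$ denotes the inverse of $\phi_\alpha$. For $f:[0,\infty)\to\mathbb{R}$ and $t>0$, the conformable derivative (or $\psi_\alpha$-derivative) of $f$ of order $\alpha$ is $$D^{\alpha}_{\psi}(f)(t)=\lim_{\varepsilon\to0}\frac{f(t+\varepsilon\,\psi_\alpha(t))-f(t)}{\varepsilon},$$ and $f$ is called $\psi_\alpha$-differentiable (also $\alpha$-differentiable) at $t$ when this limit exists. If $f$ is $\psi_\alpha$-differentiable on an interval $(0,b)$ for some $b>0$ and $\lim_{t\to0^+}D^{\alpha}_{\psi}(f)(t)$ exists, then one defines $D^{\alpha}_{\psi}(f)(0)=\lim_{t\to0^+}D^{\alpha}_{\psi}(f)(t)$,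 and $f$ is called $\psi_\alpha$-differentiable at $0$ in this case.
   Formalization: The map ψ_α is assumed continuous on (0,∞); at a = 0, differentiability of g, g'(0) and the displayed products are read as right limits at 0 of their values at positive points (the same convention as for D^α_ψ f(0)), since the claim fails otherwise. *)

(* Defs.v *)
From HB Require Import structures.
From mathcomp Require Import all_boot all_order all_algebra.
From mathcomp Require Import all_classical all_reals all_analysis.

Set Implicit Arguments.
Unset Strict Implicit.
Unset Printing Implicit Defensive.

Import Order.TTheory GRing.Theory Num.Theory.
Import numFieldNormedType.Exports.

Local Open Scope classical_set_scope.
Local Open Scope ring_scope.

(* Functions on [0, +oo[ or ]0, +oo[ are total functions R -> R; their values
   outside that domain are irrelevant. *)

(* The integral is the Lebesgue integral over ]0, t], since psi is only
   meaningful on ]0, +oo[; in particular phi psi 0 = 0. *)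
Definition phi {R : realType} (psi : R -> R) (t : R) : R :=
  Rintegral lebesgue_measure `]0, t]%classic (fun s => (psi s)^-1).

Definition phi_finite {R : realType} (psi : R -> R) : Prop :=
  forall t : R, 0 <= t ->
    lebesgue_measure.-integrable `]0, t]%classic (fun s => ((psi s)^-1)%:E).

(* The inverse of phi psi : [0, +oo[ -> [0, sup phi[, with default value 0
   outside the image. *)
Definition phi_inv {R : realType} (psi : R -> R) : R -> R :=
  'pinv_(fun=> 0) `[0, +oo[%classic (phi psi).

(* Convention for the endpoint 0, for a pointwise expression h that makes sense
   at t > 0 when P t holds: at 0, h is defined when it is defined on some
   interval ]0, b[ and has a limit from the right at 0, and its value at 0 is
   that limit. *)
Definition defined_at {R : realType} (P : R -> Prop) (h : R -> R) (t : R) :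
    Prop :=
  if t == 0 then
    (exists2 b : R, 0 < b & forall s, 0 < s < b -> P s) /\
    cvg (h s @[s --> 0^'+])
  else P t.

Definition value_at {R : realType} (h : R -> R) (t : R) : R :=
  if t == 0 then lim (h s @[s --> 0^'+]) else h t.

Definition psi_quotient {R : realType} (psi f : R -> R) (t eps : R) : R :=
  (f (t + eps * psi t) - f t) / eps.

Definition psi_derivable_pos {R : realType} (psi f : R -> R) (t : R) : Prop :=
  cvg (psi_quotient psi f t eps @[eps --> 0^']).

Definition psi_derive_pos {R : realType} (psi f : R -> R) (t : R) : R :=
  lim (psi_quotient psi f t eps @[eps --> 0^']).

Definition psi_differentiable {R : realType} (psi f : R -> R) (t : R) : Prop :=
  defined_at (psi_derivable_pos psi f) (psi_derive_pos psi f) t.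

Definition psi_derive {R : realType} (psi f : R -> R) (t : R) : R :=
  value_at (psi_derive_pos psi f) t.

(* The ordinary derivative of a function on [0, +oo[ (or [0, L[), with the same
   endpoint convention. With the one-sided difference quotient at 0 instead,
   g(0) would enter the definition and differentiability of f \o phi_inv psi at
   0 would not match psi-differentiability of f at 0 (take f = 0 on ]0, +oo[
   and f 0 = 1). *)
Definition half_differentiable {R : realType} (g : R -> R) (t : R) : Prop :=
  defined_at (fun s => derivable g s 1) (derive1 g) t.

Definition half_derive {R : realType} (g : R -> R) (t : R) : R :=
  value_at (derive1 g) t.

(* Main.v *)
(* The quotient defining the psi-derivative at t > 0 is the difference quotient
   of f at t in the direction psi t > 0, so the psi-derivative exists exactly
   when f'(t) does, and equals psi t * f'(t).  The function phi is continuous on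
   [0, +oo[ and, by the fundamental theorem of calculus, phi' = 1/psi > 0 on
   ]0, +oo[.  Hence phi is a homeomorphism of [0, b] onto [0, phi b] whose
   inverse has derivative psi t at phi t, and the chain rule settles a > 0.  At
   a = 0 all notions are limits at 0^+, and phi carries the punctured right
   neighbourhoods of 0 to one another. *)
Require Import Defs.
From HB Require Import structures.
From mathcomp Require Import all_boot all_order all_algebra.
From mathcomp Require Import all_classical all_reals all_analysis.
Import Order.TTheory GRing.Theory Num.Theory.
Import numFieldNormedType.Exports.
Local Open Scope classical_set_scope.
Local Open Scope ring_scope.

(** * Directional derivatives on the line and the conformable quotient *)

(** In dimension one derivability gives a differential, and the differential is linear in the
    direction. *)
Lemma derive_direction {R : realType} (f : R -> R) (t c : R) :
  derivable f t 1 -> derivable f t c /\ 'D_c f t = c * derive1 f t.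
Proof.
move=> /derivable1_diffP df; split; first exact: diff_derivable.
by rewrite derive1E !deriveE// -[c in LHS]mulr1 linearZ.
Qed.

Lemma derivable_directionP {R : realType} (f : R -> R) (t c : R) : c != 0 ->
  derivable f t c <-> derivable f t 1.
Proof.
move=> c0; split=> [df|/(@derive_direction _ _ _ c)[]//].
(* The quotients of [f] at [t] along [c] are those of [h] at 0 along 1; since [c != 0], [f] is
   recovered from [h] by an affine change of variable. *)
pose h (e : R) := f (e * c + t).
have dh : derivable h 0 1.
  move: df; rewrite /derivable /h /= => df.
  by under eq_fun do rewrite /= addr0 mul0r add0r [_%:A]mulr1.
have -> : f = h \o (fun x => (x - t) / c).
  by apply/funext => x; rewrite /h /= divfK// subrK.
apply/derivable1_diffP; apply: differentiable_comp.
  exact/derivable1_diffP/derivableM.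
by rewrite subrr mul0r; exact/derivable1_diffP.
Qed.

Section psi_derivative.
Context {R : realType} (psi f : R -> R) (t : R).

Lemma psi_quotientE eps :
  psi_quotient psi f t eps = eps^-1 *: (f (eps *: psi t + t) - f t).
Proof. by rewrite /psi_quotient mulrC [t + _]addrC. Qed.

Lemma psi_derivable_posP : psi t != 0 ->
  psi_derivable_pos psi f t <-> derivable f t 1.
Proof.
move=> /derivable_directionP <-; rewrite /psi_derivable_pos /derivable.
by under eq_fun do rewrite psi_quotientE.
Qed.

Lemma psi_derive_posE : derivable f t 1 ->
  psi_derive_pos psi f t = psi t * derive1 f t.
Proof.
move=> /(@derive_direction _ _ _ (psi t))[_ <-].
by rewrite /psi_derive_pos; under eq_fun do rewrite psi_quotientE.
Qed.

End psi_derivative.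

(** Turns the interval clause of [defined_at] into filter form, so that it can be carried along
    limits. *)
Lemma near_at_right0P {R : realType} (P : R -> Prop) :
  (exists2 b : R, 0 < b & forall s : R, 0 < s < b -> P s) <->
  \forall s \near 0^'+, P s.
Proof.
split=> [[b b0 Pb]|[b /= b0 Pb]].
  near=> s; apply: Pb; apply/andP; split; near: s.
    exact: nbhs_right_gt.
  exact: nbhs_right_lt.
exists b => // s /andP[s0 sb]; apply: Pb => //.
by rewrite /= sub0r normrN gtr0_norm.
Unshelve. all: by end_near. Qed.

(** * Change of variable for the endpoint convention *)

Section endpoint_transport.
Context {R : realType} (u v : R -> R).
Hypotheses (u0 : u 0 = 0) (u_gt0 : forall s : R, 0 < s -> 0 < u s).
Hypotheses (u_cvg : u s @[s --> 0^'+] --> 0^'+).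
Hypotheses (v_cvg : v s @[s --> 0^'+] --> 0^'+).
Hypothesis uK : \forall s \near 0^'+, u (v s) = s.
Variables (P Q : R -> Prop) (h k : R -> R).
Hypothesis PQ : forall s : R, 0 < s -> P s <-> Q (u s).
Hypothesis hk : forall s : R, 0 < s -> P s -> h s = k (u s).

(** From left to right, [P] holds at [v s] for small [s], hence [Q] at [u (v s) = s]; conversely [Q]
    holds at [u s], since [u s] tends to 0 from the right. *)
Lemma near_transport :
  (\forall s \near 0^'+, P s) <-> (\forall s \near 0^'+, Q s).
Proof.
split=> [/v_cvg Pv|/u_cvg Qu].
  near=> s; have <- : u (v s) = s by near: s.
  apply: (iffLR (PQ _ _)); last by near: s.
  by near: s; exact: (v_cvg _ (nbhs_right_gt 0)).
near=> s; apply: (iffRL (PQ _ _)); last by near: s.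
by near: s; exact: nbhs_right_gt.
Unshelve. all: by end_near. Qed.

(** Near 0, [k s = h (v s)] and [h s = k (u s)]; each limit follows from the other by
    composition. *)
Lemma cvg_transport (l : R) : (\forall s \near 0^'+, P s) ->
  h s @[s --> 0^'+] --> l <-> k s @[s --> 0^'+] --> l.
Proof.
move=> Pnear; split=> [hl|kl].
  apply: cvg_trans (cvg_comp _ _ v_cvg hl); apply: near_eq_cvg; near=> s.
  rewrite /= hk; first by congr k; near: s.
    by near: s; exact: (v_cvg _ (nbhs_right_gt 0)).
  by near: s; exact: (v_cvg _ Pnear).
apply: cvg_trans (cvg_comp _ _ u_cvg kl); apply: near_eq_cvg; near=> s.
rewrite /= hk//; near: s => //; exact: nbhs_right_gt.
Unshelve. all: by end_near. Qed.

(** A pointwise correspondence at positive points extends to the endpoint: [u] fixes 0, and both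
    sides there are the same limit. *)
Lemma at_transport (a : R) : 0 <= a ->
  (defined_at P h a <-> defined_at Q k (u a)) /\
  (defined_at P h a -> value_at h a = value_at k (u a)).
Proof.
rewrite /defined_at /value_at le_eqVlt => /predU1P[<-|a0]; last first.
  by rewrite !gt_eqF ?u_gt0//; split; [exact: PQ|exact: hk].
rewrite u0 eqxx !near_at_right0P -near_transport; split.
  by split=> -[Pn /cvg_ex[l hl]]; split=> //; apply/cvg_ex; exists l;
    apply/(cvg_transport _ Pn).
move=> [Pn /cvg_ex[l hl]].
have kl : k s @[s --> 0^'+] --> l by exact/(cvg_transport _ Pn).
by rewrite (cvg_lim (@Rhausdorff R) hl) (cvg_lim (@Rhausdorff R) kl).
Qed.

End endpoint_transport.

(** * The function [phi psi] and its inverse *)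

Section phi_theory.
Context {R : realType} (psi : R -> R).
Hypothesis psi_gt0 : forall t : R, 0 < t -> 0 < psi t.
Hypothesis psi_cont : forall t : R, 0 < t -> {for t, continuous psi}.
Hypothesis phi_fin : phi_finite psi.

Lemma phi0 : phi psi 0 = 0.
Proof. by rewrite /phi set_itvoc0 Rintegral_set0. Qed.

Lemma is_derive_phi (t : R) : 0 < t -> is_derive t 1 (phi psi) (psi t)^-1.
Proof.
move=> t0; have t1 : t < t + 1 by rewrite ltrDl.
(* The left bound [BRight 0] gives the interval open at 0 used in [phi]; integrability up to [t + 1]
   leaves room to the right of [t]. *)
have [|||df dE] :=
  @continuous_FTC1 R (fun s => (psi s)^-1) (BRight 0) t (t + 1) t1.
- by apply: phi_fin; rewrite addr_ge0// ltW.
- exact: t0.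
- by apply: continuousV; [rewrite gt_eqF// psi_gt0|exact: psi_cont].
have -> : (psi t)^-1 = derive1 (phi psi) t by rewrite dE.
by rewrite derive1E; exact/derivableP.
Qed.

Lemma continuous_phi (t : R) : 0 < t -> {for t, continuous (phi psi)}.
Proof.
move=> /is_derive_phi[/derivable1_diffP df _].
exact: differentiable_continuous.
Qed.

Lemma phi_cvg_right0 : phi psi s @[s --> 0^'+] --> 0.
Proof.
(* Continuity of the integral in its upper endpoint is applied on closed intervals; adding the null
   set {0} changes neither integrability nor the integral, whatever [psi 0] is. *)
have int01 : lebesgue_measure.-integrable `[0, 1]%classic
    (EFin \o (fun s => (psi s)^-1)).
  have /integrableP[mpsi ipsi] := phi_fin _ ler01.
  apply/integrableP; split.
    exact/measurable_realfun.emeasurable_fun_itv_obnd_cbndP.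
  rewrite -integral_itv_obnd_cbnd//.
  exact: (measurable_int _ (integrable_abse (phi_fin _ ler01))).
have /cvg_at_right_filter := parameterized_integral_cvg_left ltr01 int01.
apply: cvg_trans; apply: near_eq_cvg; near=> s.
rewrite /parameterized_integral -Rintegral_itv_obnd_cbnd//.
by apply: phi_fin; near: s; exact: nbhs_right_ge.
Unshelve. all: by end_near. Qed.

Lemma phi_continuous_itv (b : R) : 0 < b ->
  {within `[0, b], continuous (phi psi)}.
Proof.
move=> b0; apply/(continuous_within_itvP _ b0); split.
- by move=> x /[!in_itv]/andP[x0 _]; exact: continuous_phi.
- by rewrite phi0; exact: phi_cvg_right0.
- exact/cvg_at_left_filter/continuous_phi.
Qed.

Lemma phi_lt (x y : R) : 0 <= x -> x < y -> phi psi x < phi psi y.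
Proof.
move=> x0 xy; have y0 : 0 < y := le_lt_trans x0 xy.
(* A positive derivative inside and continuity up to the ends suffice, so [x = 0] is covered. *)
apply: (@gtr0_derive1_lt_cc _ (phi psi) 0 y) => //.
- by move=> z /[!in_itv]/andP[/is_derive_phi[]].
- move=> z /[!in_itv]/andP[z0 _]; have [_] := is_derive_phi z z0.
  by rewrite derive1E => ->; rewrite invr_gt0 psi_gt0.
- exact: phi_continuous_itv.
- by rewrite in_itv /= x0 ltW.
- by rewrite in_itv /= ltW /=.
Qed.

Lemma phi_gt0 (t : R) : 0 < t -> 0 < phi psi t.
Proof. by move=> t0; rewrite -phi0; exact: phi_lt. Qed.

Lemma phiK (t : R) : 0 <= t -> phi_inv psi (phi psi t) = t.
Proof.
(* The partial inverse cancels on the left once [phi psi] is injective on [0, +oo[, which strict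
   monotonicity gives. *)
move=> t0; apply: pinvKV; last by rewrite inE /= in_itv /= t0.
move=> x y; rewrite !inE /= !in_itv /= !andbT => x0 y0 xy.
case: (ltgtP x y) => // /phi_lt; rewrite xy ltxx.
  by move=> /(_ x0).
by move=> /(_ y0).
Qed.

Lemma near_phiK (t : R) : 0 < t -> {near t, cancel (phi psi) (phi_inv psi)}.
Proof.
move=> t0; near=> x; apply/phiK/ltW; near: x; exact: lt_nbhsr.
Unshelve. all: by end_near. Qed.

Lemma is_derive_phi_inv (t : R) : 0 < t ->
  is_derive (phi psi t) 1 (phi_inv psi) (psi t).
Proof.
move=> t0; rewrite -[psi t]invrK; apply: is_derive_inverse.
- exact: near_phiK.
- near=> x; apply: continuous_phi; near: x; exact: lt_nbhsr.
- exact: is_derive_phi.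
- by rewrite invr_neq0// gt_eqF// psi_gt0.
Unshelve. all: by end_near. Qed.

(** The bound [phi psi b] keeps [y] in the image, away from the default value of [phi_inv]. The
    intermediate value theorem gives a preimage in [0, b], which [phiK] identifies; the strict
    bounds on [y] exclude the ends. *)
Lemma phi_inv_itv (b y : R) : 0 < b -> 0 < y < phi psi b ->
  0 < phi_inv psi y < b /\ phi psi (phi_inv psi y) = y.
Proof.
move=> b0 /andP[y0 yb].
have phi0b : phi psi 0 <= phi psi b by rewrite phi0 ltW// phi_gt0.
have [|x /= /[!in_itv]/= /andP[x0 xb] xy] :=
  segment_continuous_le_surjective (ltW b0) phi0b (phi_continuous_itv _ b0)
    (t := y).
  by rewrite /= in_itv /= phi0 !ltW.
rewrite -xy phiK//; split=> //; rewrite !lt_neqAle x0 xb !andbT.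
apply/andP; split; apply/eqP => xE.
  by move: y0; rewrite -xy -xE phi0 ltxx.
by move: yb; rewrite -xy xE ltxx.
Qed.

Lemma phi_cvg_right : phi psi s @[s --> 0^'+] --> 0^'+.
Proof.
move=> A [e /= e0 eA].
have /cvgrPdist_lt/(_ e e0) := phi_cvg_right0; apply: filter_app; near=> s.
move=> se; apply: eA => //; apply: phi_gt0.
by near: s; exact: nbhs_right_gt.
Unshelve. all: by end_near. Qed.

Lemma phi_inv_cvg_right : phi_inv psi s @[s --> 0^'+] --> 0^'+.
Proof.
move=> A /near_at_right0P[e e0 eA].
change (\forall s \near 0^'+, A (phi_inv psi s)); near=> s; apply: eA.
(* The threshold is [phi psi e]: below it, [phi_inv psi s] stays below [e]. *)
have [|//] := phi_inv_itv e s e0 _; apply/andP; split; near: s.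
  exact: nbhs_right_gt.
by apply: nbhs_right_lt; exact: phi_gt0.
Unshelve. all: by end_near. Qed.

Lemma near_phi_invK : \forall s \near 0^'+, phi psi (phi_inv psi s) = s.
Proof.
near=> s; have [|//] := phi_inv_itv 1 s ltr01 _; apply/andP; split; near: s.
  exact: nbhs_right_gt.
by apply: nbhs_right_lt; exact: phi_gt0.
Unshelve. all: by end_near. Qed.

Lemma is_derive_comp_phi_inv (f : R -> R) (t : R) : 0 < t -> derivable f t 1 ->
  is_derive (phi psi t) 1 (f \o phi_inv psi) (derive1 f t * psi t).
Proof.
move=> t0 /derivableP df; apply: is_derive1_comp; last exact: is_derive_phi_inv.
by rewrite phiK ?ltW// derive1E.
Qed.

Lemma derivable_comp_phi_invP (f : R -> R) (t : R) : 0 < t ->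
  derivable f t 1 <-> derivable (f \o phi_inv psi) (phi psi t) 1.
Proof.
move=> t0; split=> [/(is_derive_comp_phi_inv _ _ t0)[]//|dg].
(* Near [t], [f] is the composite with [phi_inv psi] followed back along [phi psi], so the chain
   rule applies in this direction too. *)
apply: (@near_eq_derivable _ _ _ ((f \o phi_inv psi) \o phi psi)).
  by near=> x; rewrite /= (near (near_phiK _ t0)).
apply/derivable1_diffP; apply: differentiable_comp; apply/derivable1_diffP => //.
by have [] := is_derive_phi _ t0.
Unshelve. all: by end_near. Qed.

End phi_theory.

(** * Comparison of the four expressions, at positive points and then at 0 *)

Theorem theorem1 (R : realType) (psi : R -> R -> R) (alpha : R)
    (halpha : 0 < alpha < 1)
    (psi_bij : set_bij `]0, +oo[%classic `]0, +oo[%classic (psi alpha))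
    (psi_cont : forall t : R, 0 < t -> {for t, continuous (psi alpha)})
    (phi_fin : phi_finite (psi alpha))
    (f : R -> R) (a : R) (ha : 0 <= a) :
  let g := fun tau : R => f (phi_inv (psi alpha) tau) in
  let tau_a := phi (psi alpha) a in
  let chain := fun tau : R =>
    derive1 f (phi_inv (psi alpha) tau) * derive1 (phi_inv (psi alpha)) tau in
  let prod := fun t : R => psi alpha t * derive1 f t in
  (psi_differentiable (psi alpha) f a <-> half_differentiable g tau_a) /\
  (psi_differentiable (psi alpha) f a ->
    [/\ defined_at (fun tau => derivable f (phi_inv (psi alpha) tau) 1 /\
                               derivable (phi_inv (psi alpha)) tau 1)
                   chain tau_a,
        defined_at (fun t => derivable f t 1) prod a,
        psi_derive (psi alpha) f a = half_derive g tau_a,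
        half_derive g tau_a = value_at chain tau_a &
        value_at chain tau_a = value_at prod a]).
Proof.
move=> g tau_a chain prod.
have psi_gt0 (t : R) : 0 < t -> 0 < psi alpha t.
  move=> t0; case: psi_bij => psiS _ _.
  by have := psiS t; rewrite /= !in_itv /= !andbT; exact.
have psi_derivP (t : R) : 0 < t ->
    psi_derivable_pos (psi alpha) f t <-> derivable f t 1.
  by move=> t0; apply: psi_derivable_posP; rewrite gt_eqF// psi_gt0.
have psi_prod (t : R) : 0 < t -> psi_derivable_pos (psi alpha) f t ->
    psi_derive_pos (psi alpha) f t = prod t.
  by move=> t0 /(iffLR (psi_derivP _ t0)); exact: psi_derive_posE.
have phiK' (t : R) : 0 < t -> phi_inv (psi alpha) (phi (psi alpha) t) = t.
  by move=> /ltW; exact: phiK.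
have u0 := phi0 (psi alpha).
have u_gt0 := phi_gt0 _ psi_gt0 psi_cont phi_fin.
have u_cvg := phi_cvg_right _ psi_gt0 psi_cont phi_fin.
have v_cvg := phi_inv_cvg_right _ psi_gt0 psi_cont phi_fin.
have uK := near_phi_invK _ psi_gt0 psi_cont phi_fin.
have g_iff (t : R) : 0 < t -> psi_derivable_pos (psi alpha) f t <->
    derivable g (phi (psi alpha) t) 1.
  by move=> t0; rewrite psi_derivP//; exact: derivable_comp_phi_invP.
have g_val (t : R) : 0 < t -> psi_derivable_pos (psi alpha) f t ->
    psi_derive_pos (psi alpha) f t = derive1 g (phi (psi alpha) t).
  move=> t0 dt; rewrite psi_prod// /prod mulrC [in RHS]derive1E.
  have df := iffLR (psi_derivP _ t0) dt.
  by have [_ ->] := is_derive_comp_phi_inv _ psi_gt0 psi_cont phi_fin _ _ t0 df.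
have c_iff (t : R) : 0 < t -> psi_derivable_pos (psi alpha) f t <->
    derivable f (phi_inv (psi alpha) (phi (psi alpha) t)) 1 /\
    derivable (phi_inv (psi alpha)) (phi (psi alpha) t) 1.
  (* Derivability of the inverse at [phi (psi alpha) t] is automatic, so only derivability of [f] at
     [t] remains. *)
  move=> t0; rewrite psi_derivP// phiK'//; split=> [df|[]//]; split=> //.
  by have [] := is_derive_phi_inv _ psi_gt0 psi_cont phi_fin _ t0.
have c_val (t : R) : 0 < t -> psi_derivable_pos (psi alpha) f t ->
    psi_derive_pos (psi alpha) f t = chain (phi (psi alpha) t).
  move=> t0 dt; rewrite psi_prod// /chain phiK'// mulrC [in RHS]derive1E.
  by have [_ ->] := is_derive_phi_inv _ psi_gt0 psi_cont phi_fin _ t0.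
have phi_transport := at_transport _ _ u0 u_gt0 u_cvg v_cvg uK.
have [gD gV] :=
  phi_transport _ (fun tau => derivable g tau 1) _ _ g_iff g_val _ ha.
have [cD cV] := phi_transport _
  (fun tau => derivable f (phi_inv (psi alpha) tau) 1 /\
              derivable (phi_inv (psi alpha)) tau 1) _ _ c_iff c_val _ ha.
(* The product is an expression in [t] itself, so it is compared by transport along the identity. *)
have idK : \forall s \near (0 : R)^'+, id (id s) = s by exact: nearW.
have [pD pV] := at_transport id id erefl (fun s s0 => s0) cvg_id cvg_id
  idK _ (fun t => derivable f t 1) _ _ psi_derivP psi_prod _ ha.
split; first exact: gD.
move=> df; split.
- exact/cD.
- exact/pD.
- exact: gV.
- by rewrite /half_derive -gV// cV.
- by rewrite -cV// pV.
Qed.
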